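(* Let $X$ be a real Banach space with $\dim X\ge 2$ and let $0<\lambda<1$. Then $$J_\lambda^\perp(X)=1 \quad\Longleftrightarrow\quad J_\perp(X)=2.$$ Consequently, $$J_\lambda^\perp(X)=1 \quad\Longleftrightarrow\quad X \text{ is not uniformly nonsquare}.$$
   Context: For a real Banach space $X$, $S_X=\{x\in X:\|x\|=1\}$. For $x,y\in X$, $x\perp_B y$ (Birkhoff--James orthogonality) means $\|x\|\le\|x+ty\|$ for every $t\in\mathbb R$. For $\lambda\in[0,1]$, $$J_\lambda^\perp(X)=\sup\{\min\{\|\lambda x+(1-\lambda)y\|,\|\lambda x-(1-\lambda)y\|\}: x,y\in S_X,\ x\perp_B y\}.$$ The orthogonal James constant is $J_\perp(X)=\sup\{\min\{\|x+y\|,\|x-y\|\}: x,y\in S_X,\ x\perp_B y\}$. $X$ is uniformly nonsquare if there exists $\varepsilon>0$ such that $\min\{\|x+y\|,\|x-y\|\}\le 2-\varepsilon$ for all $x,y\in S_X$. *)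

(* Defs.v *)
From HB Require Import structures.
From mathcomp Require Import all_boot all_order all_algebra.
From mathcomp Require Import all_classical all_reals all_analysis.
Import Order.TTheory GRing.Theory Num.Theory.
Import numFieldNormedType.Exports.

Set Implicit Arguments.
Unset Strict Implicit.
Unset Printing Implicit Defensive.

Local Open Scope classical_set_scope.
Local Open Scope ring_scope.

Section OrthogonalConstants.
Variables (R : realType) (X : completeNormedModType R).

(* X has two linearly independent vectors; X may be infinite-dimensional. *)
Definition dim_ge2 : Prop :=
  exists x y : X, forall a b : R, a *: x + b *: y = 0 -> a = 0 /\ b = 0.

Definition unit_sphere : set X := [set x | `|x| = 1].

Definition birkhoff_james_orth (x y : X) : Prop :=
  forall t : R, `|x| <= `|x + t *: y|.

(* The real-valued [sup] is 0 on sets that are empty or unbounded above. The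
   sets below are bounded (by 1 for 0 <= lambda <= 1, and by 2, respectively),
   and they are nonempty as soon as dim X >= 2. *)
Definition J_lambda_perp (lambda : R) : R :=
  sup [set r : R | exists x y : X,
    [/\ unit_sphere x, unit_sphere y, birkhoff_james_orth x y &
        r = Num.min `|lambda *: x + (1 - lambda) *: y|
                    `|lambda *: x - (1 - lambda) *: y|]].

Definition J_perp : R :=
  sup [set r : R | exists x y : X,
    [/\ unit_sphere x, unit_sphere y, birkhoff_james_orth x y &
        r = Num.min `|x + y| `|x - y|]].

Definition uniformly_nonsquare : Prop :=
  exists eps : R, 0 < eps /\
    forall x y : X, unit_sphere x -> unit_sphere y ->
      Num.min `|x + y| `|x - y| <= 2 - eps.

End OrthogonalConstants.

Arguments dim_ge2 {R} X.
Arguments unit_sphere {R} X.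
Arguments J_lambda_perp {R} X lambda.
Arguments J_perp {R} X.
Arguments uniformly_nonsquare {R} X.

(* Main.v *)
Require Import Defs.
From HB Require Import structures.
From mathcomp Require Import all_boot all_order all_algebra.
From mathcomp Require Import all_classical all_reals all_analysis.
From mathcomp Require Import ring lra.
Import Order.TTheory GRing.Theory Num.Theory.
Import numFieldNormedType.Exports.

Set Implicit Arguments.
Unset Strict Implicit.
Unset Printing Implicit Defensive.

Local Open Scope ring_scope.

(** Both constants are suprema over the same pairs of orthogonal unit vectors,
    and both equalities say that such pairs can be made almost square.

    The first equivalence is convexity of the norm: for unit vectors,
    [`|x + y|] is close to 2 exactly when
    [`|lambda *: x + (1 - lambda) *: y|] is close to 1
    ([norm_add_ge_of_convex], [norm_convex_ge_of_add]); applied to [y] and to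
    [- y], this transfers almost extremal pairs from one constant to the other.

    For the second one, let [x], [y] be unit vectors such that [`|x + y|] and
    [`|x - y|] exceed [2 - e]. Then the norm on their span is almost that of
    l_1, i.e. [`|x + t *: y| >= (1 - e) * (1 + `|t|)]
    ([almost_square_ell1_ge]). A minimizer [t0] of [`|x + t *: y|] gives a
    vector [x + t0 *: y] orthogonal to [y]; the minimum is at most [`|x| = 1],
    so the l_1 estimate forces [t0] to be of order [e]. Normalizing
    [x + t0 *: y] thus moves [x] only by O(e), and yields an orthogonal pair
    that is still almost square ([almost_square_orth]). It matters that [x] is
    corrected along [y]: correcting [y] along [x] to get [x] orthogonal to the
    new vector may need a large change, as support functionals at [x] can take
    values close to 1 at [y]. *)

(** A supremum of an empty or unbounded set is 0, hence a positive value
    certifies that approximating elements exist. *)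
Lemma sup_eq_ubP (R : realType) (E : set R) (B : R) :
  0 < B -> ubound E B ->
  sup E = B <-> forall e : R, 0 < e -> exists2 r, E r & B - e < r.
Proof.
move=> B0 EB; split=> [supE e e0|approx].
  have hE : has_sup E.
    by apply: contrapT => /sup_out E0; move: B0; rewrite -supE E0 ltxx.
  by rewrite -supE; exact: sup_adherent.
have E0 : (E !=set0)%classic.
  by have [r Er _] := approx 1 ltr01; exists r.
have hE : has_sup E by split=> //; exists B.
apply/eqP; rewrite eq_le ge_sup//=; apply/ler_addgt0Pr => e e0.
have [r Er ltr] := approx e e0.
have := ub_le_sup hE.2 Er; lra.
Qed.

(** * Almost extremal convex combinations *)

Section ConvexCombinations.
Variables (R : realType) (X : normedModType R).
Implicit Types (x y : X) (l e : R).

Lemma norm_convex_le1 x y l : `|x| = 1 -> `|y| = 1 -> 0 <= l <= 1 ->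
  `|l *: x + (1 - l) *: y| <= 1.
Proof.
move=> x1 y1 /andP[l0 l1]; apply: (le_trans (ler_normD _ _)).
rewrite !normrZ x1 y1 !ger0_norm//; lra.
Qed.

(** With [l <= 1/2], the combination is itself a combination of the midpoint of
    [x], [y] and of [y]; a norm close to 1 must then come from the midpoint. *)
Lemma norm_add_ge_of_convex_half x y l e : `|y| = 1 -> 0 < l <= 2^-1 ->
  1 - l * e < `|l *: x + (1 - l) *: y| -> 2 - e < `|x + y|.
Proof.
move=> y1 /andP[l0 l1].
have -> : l *: x + (1 - l) *: y = l *: (x + y) + (1 - l *+ 2) *: y.
  by rewrite scalerDr -addrA -scalerDl; congr (_ + _ *: _); ring.
move=> /lt_le_trans/(_ (ler_normD _ _)).
rewrite !normrZ y1 (gtr0_norm l0) ger0_norm; last by lra.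
move=> H; rewrite -(ltr_pM2l l0); lra.
Qed.

(** One of the two coefficients is at most 1/2; the minimum in the hypothesis
    covers both cases. *)
Lemma norm_add_ge_of_convex x y l e : `|x| = 1 -> `|y| = 1 -> 0 < l < 1 ->
  0 < e -> 1 - Num.min l (1 - l) * e < `|l *: x + (1 - l) *: y| ->
  2 - e < `|x + y|.
Proof.
move=> x1 y1 /andP[l0 l1] e0 H.
have [lh|lh] := leP l 2^-1.
  apply: (norm_add_ge_of_convex_half (l := l)) => //; first by rewrite l0.
  by move: H; rewrite min_l//; lra.
rewrite [x + y]addrC; apply: (norm_add_ge_of_convex_half (l := 1 - l)) => //; first lra.
by move: H; rewrite min_r ?[_ + (1 - l) *: y]addrC ?subKr//; lra.
Qed.

(** The combination and its mirror image [(1 - l) *: x + l *: y] add up to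
    [x + y], and the mirror image has norm at most 1. *)
Lemma norm_convex_ge_of_add x y l : `|x| = 1 -> `|y| = 1 -> 0 <= l <= 1 ->
  `|x + y| - 1 <= `|l *: x + (1 - l) *: y|.
Proof.
move=> x1 y1 l01.
have -> : x + y = (l *: x + (1 - l) *: y) + (l *: y + (1 - l) *: x).
  rewrite [l *: y + _]addrC addrACA -!scalerDl subrKC subrK.
  by rewrite !scale1r.
rewrite lerBlDr; apply: (le_trans (ler_normD _ _)).
by rewrite lerD2l; exact: norm_convex_le1.
Qed.

End ConvexCombinations.

(** * From almost square pairs to orthogonal ones *)

Section AlmostSquarePairs.
Variables (R : realType) (X : normedModType R).
Implicit Types (x y : X) (e t : R).

(** Going from [x + t *: y] to [x + y] if [t <= 1], or to [t *: (x + y)] if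
    [t > 1], costs [`|1 - t|] in norm. *)
Lemma norm_add_scale_ge x y e t : `|x| = 1 -> `|y| = 1 -> 0 <= e ->
  0 <= t -> 2 - e < `|x + y| -> (1 - e) * (1 + t) <= `|x + t *: y|.
Proof.
move=> x1 y1 e0 t0 xy.
have [t1|t1] := leP t 1.
  have : `|x + y| <= `|x + t *: y| + (1 - t).
    have -> : x + y = (x + t *: y) + (1 - t) *: y.
      by rewrite -addrA -scalerDl subrKC scale1r.
    apply: (le_trans (ler_normD _ _)).
    by rewrite normrZ y1 mulr1 ger0_norm//; lra.
  nra.
have : t * `|x + y| <= `|x + t *: y| + (t - 1).
  rewrite -{1}(ger0_norm t0) -normrZ.
  have -> : t *: (x + y) = (x + t *: y) + (t - 1) *: x.
    by rewrite scalerDr addrAC -{2}[x]scale1r -scalerDl subrKC.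
  apply: (le_trans (ler_normD _ _)).
  by rewrite normrZ x1 mulr1 ger0_norm//; lra.
nra.
Qed.

(** Negative [t] amounts to replacing [y] by [- y], which exchanges the two
    lower bounds. As the triangle inequality bounds the norm by [1 + `|t|],
    the span of [x] and [y] is almost isometric to the two-dimensional l_1. *)
Lemma almost_square_ell1_ge x y e t : `|x| = 1 -> `|y| = 1 -> 0 <= e ->
  2 - e < `|x + y| -> 2 - e < `|x - y| ->
  (1 - e) * (1 + `|t|) <= `|x + t *: y|.
Proof.
move=> x1 y1 e0 xy xNy; have [t0|t0] := ger0P t.
  exact: norm_add_scale_ge.
have -> : t *: y = (- t) *: (- y) by rewrite scaleNr scalerN opprK.
by apply: norm_add_scale_ge; rewrite ?normrN// oppr_ge0 ltW.
Qed.

(** Since [`|x + t *: y|] is at least 1 for [`|t| >= 2], it is enough to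
    minimize over a compact interval. *)
Lemma exists_norm_minimizer x y : `|x| = 1 -> `|y| = 1 ->
  exists t0, forall t, `|x + t0 *: y| <= `|x + t *: y|.
Proof.
move=> x1 y1; pose f t := `|x + t *: y|.
have fc : continuous f.
  move=> t; apply: (@cvg_comp _ _ _ (fun t => x + t *: y) (fun z => `|z|)).
    apply: cvgD; first exact: cvg_cst.
    by apply: cvgZ; [exact: cvg_id|exact: cvg_cst].
  exact: norm_continuous.
have [||t0 t0in t0min] := @EVT_min R f (- 2) 2; first lra.
  exact: continuous_subspaceT.
exists t0 => t; have [tin|] := boolP (t \in `[(- 2 : R), 2]); first exact: t0min.
rewrite in_itv/= -ler_norml -ltNge => t2.
have f0 : f 0 = 1 by rewrite /f scale0r addr0.
apply: (@le_trans _ _ (f 0)).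
  by apply: t0min; rewrite in_itv/= oppr_le0 ler0n.
rewrite f0; have := lerB_normD (t *: y) x.
by rewrite normrZ x1 y1 [t *: y + x]addrC; lra.
Qed.

End AlmostSquarePairs.

Section Orthogonalization.
Variables (R : realType) (X : completeNormedModType R).
Implicit Types (x y : X) (e : R).

Lemma birkhoff_james_orthZl x y (a : R) :
  a != 0 -> birkhoff_james_orth x y -> birkhoff_james_orth (a *: x) y.
Proof.
move=> a0 xy t.
have -> : a *: x + t *: y = a *: (x + (a^-1 * t) *: y).
  by rewrite scalerDr scalerA mulVKf.
by rewrite !normrZ; apply: ler_wpM2l.
Qed.

(** [u] is the normalization of [x + t0 *: y], with [t0] minimizing the norm.
    Its distance to [x] is at most [`|t0| + (1 - `|x + t0 *: y|)], where the
    l_1 estimate bounds the first term by [2 * e] and the second by [e]. *)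
Lemma almost_square_orth x y e : `|x| = 1 -> `|y| = 1 -> 0 < e <= 2^-1 ->
  2 - e < `|x + y| -> 2 - e < `|x - y| ->
  exists u : X, [/\ `|u| = 1, birkhoff_james_orth u y & `|x - u| <= 3 * e].
Proof.
move=> x1 y1 /andP[e0 e1] xy xNy.
have [t0 t0min] := exists_norm_minimizer x1 y1.
set z := x + t0 *: y.
have zle1 : `|z| <= 1 by have := t0min 0; rewrite scale0r addr0 x1.
have zge := almost_square_ell1_ge t0 x1 y1 (ltW e0) xy xNy.
have t0ge := normr_ge0 t0.
have z0 : 0 < `|z| by apply: lt_le_trans zge; nra.
exists (`|z|^-1 *: z); split.
- by rewrite normrZ normfV normr_id mulVf// gt_eqF.
- apply: birkhoff_james_orthZl; first by rewrite invr_eq0 gt_eqF.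
  by move=> t; rewrite -addrA -scalerDl; exact: t0min.
have uz : `|z - `|z|^-1 *: z| = 1 - `|z|.
  rewrite -{1}[z]scale1r -scalerBl normrZ ler0_norm.
    by rewrite opprB mulrBl mul1r mulVf// gt_eqF.
  by rewrite subr_le0 invf_ge1.
have xz : `|x - z| = `|t0|.
  by rewrite /z opprD addNKr normrN normrZ y1 mulr1.
rewrite -[x](subrK z) -addrA; apply: (le_trans (ler_normD _ _)).
rewrite uz xz.
have : (1 - e) * (1 + `|t0|) <= 1 by exact: le_trans zge _.
move: zge; rewrite -/z; nra.
Qed.

End Orthogonalization.

(** * The constants *)

Section Constants.
Variables (R : realType) (X : completeNormedModType R).

Lemma J_perp_eq2P : J_perp X = 2 <-> forall e : R, 0 < e ->
  exists x y : X, [/\ `|x| = 1, `|y| = 1, birkhoff_james_orth x y,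
    2 - e < `|x + y| & 2 - e < `|x - y|].
Proof.
rewrite /J_perp; apply: (iff_trans (sup_eq_ubP _ _)) => //.
  move=> _ [x [y [x1 y1 _ ->]]]; rewrite ge_min; apply/orP; left.
  by apply: (le_trans (ler_normD _ _)); rewrite x1 y1.
split=> H e /H.
  move=> [_ [x [y [x1 y1 xy ->]]]]; rewrite lt_min => /andP[? ?].
  by exists x, y.
move=> [x [y [x1 y1 xy p m]]]; eexists; first by exists x, y.
by rewrite lt_min p.
Qed.

Lemma J_lambda_perp_eq1P (l : R) : 0 <= l <= 1 ->
  J_lambda_perp X l = 1 <-> forall e : R, 0 < e ->
  exists x y : X, [/\ `|x| = 1, `|y| = 1, birkhoff_james_orth x y,
    1 - e < `|l *: x + (1 - l) *: y| & 1 - e < `|l *: x - (1 - l) *: y|].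
Proof.
move=> l01; rewrite /J_lambda_perp.
apply: (iff_trans (sup_eq_ubP _ _)) => //.
  move=> _ [x [y [x1 y1 _ ->]]]; rewrite ge_min; apply/orP; left.
  exact: norm_convex_le1.
split=> H e /H.
  move=> [_ [x [y [x1 y1 xy ->]]]]; rewrite lt_min => /andP[? ?].
  by exists x, y.
move=> [x [y [x1 y1 xy p m]]]; eexists; first by exists x, y.
by rewrite lt_min p.
Qed.

Lemma not_uniformly_nonsquareP : ~ uniformly_nonsquare X <->
  forall e : R, 0 < e -> exists x y : X, [/\ `|x| = 1, `|y| = 1,
    2 - e < `|x + y| & 2 - e < `|x - y|].
Proof.
split=> [nU e e0|H [e [e0 U]]].
  apply: contrapT => nxy; apply: nU; exists e; split=> // x y x1 y1.
  rewrite leNgt lt_min; apply/negP => /andP[p m]; apply: nxy.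
  by exists x, y.
have [x [y [x1 y1 p m]]] := H e e0.
by have := U x y x1 y1; rewrite leNgt lt_min p m.
Qed.

Lemma J_lambda_perp_eq1_J_perp (l : R) : 0 < l < 1 ->
  J_lambda_perp X l = 1 <-> J_perp X = 2.
Proof.
move=> l01; have l01w : 0 <= l <= 1 by lra.
apply: (iff_trans (J_lambda_perp_eq1P l01w)).
apply: (iff_trans _ (iff_sym J_perp_eq2P)); split=> H e e0.
  have m0 : 0 < Num.min l (1 - l) by rewrite lt_min; lra.
  have [x [y [x1 y1 xy p m]]] := H _ (mulr_gt0 m0 e0).
  exists x, y; split=> //; first exact: norm_add_ge_of_convex p.
  apply: (norm_add_ge_of_convex (l := l)); rewrite ?normrN// scalerN.
  exact: m.
have [x [y [x1 y1 xy p m]]] := H e e0.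
exists x, y; split=> //.
  have := norm_convex_ge_of_add x1 y1 l01w; lra.
have yN1 : `|- y| = 1 by rewrite normrN.
have := norm_convex_ge_of_add x1 yN1 l01w; rewrite scalerN; lra.
Qed.

Lemma J_perp_eq2_not_uniformly_nonsquare :
  J_perp X = 2 <-> ~ uniformly_nonsquare X.
Proof.
apply: (iff_trans J_perp_eq2P).
apply: (iff_trans _ (iff_sym not_uniformly_nonsquareP)); split=> H e e0.
  by have [x [y [x1 y1 _ p m]]] := H e e0; exists x, y.
(* The quarter absorbs the defect d of the given pair and the displacement
   3 * d of its first vector. *)
pose d := Num.min (e / 4) 2^-1.
have d0 : 0 < d by rewrite lt_min; lra.
have d1 : d <= 2^-1 by rewrite ge_min lexx orbT.
have de : d <= e / 4 by rewrite ge_min lexx.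
have [x [y [x1 y1 p m]]] := H d d0.
have d01 : 0 < d <= 2^-1 by rewrite d0.
have [u [u1 uy xu]] := almost_square_orth x1 y1 d01 p m.
have close (w : X) : `|x + w| <= `|u + w| + 3 * d.
  rewrite -[x](subrK u) -addrA addrC; apply: (le_trans (ler_normD _ _)).
  by rewrite lerD2l.
exists u, y; split=> //; [have := close y|have := close (- y)]; lra.
Qed.

End Constants.

Unset Implicit Arguments.

Theorem theorem3p5 (R : realType) (X : completeNormedModType R)
    (hdim : dim_ge2 X) (lambda : R) (hlambda0 : 0 < lambda)
    (hlambda1 : lambda < 1) :
  (J_lambda_perp X lambda = 1 <-> J_perp X = 2) /\
  (J_lambda_perp X lambda = 1 <-> ~ uniformly_nonsquare X).
Proof.
have l01 : 0 < lambda < 1 by rewrite hlambda0.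
have JJ := J_lambda_perp_eq1_J_perp X l01.
split=> //; apply: (iff_trans JJ).
exact: J_perp_eq2_not_uniformly_nonsquare.
Qed.
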